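(* For every finite non-empty connected quasi-poset $P$: $$\alpha_P=\frac{d\,ehr_P}{dX}(0),\qquad \alpha^{str}_P=\frac{d\,ehr^{str}_P}{dX}(0).$$ For any quasi-poset $P$: $$ehr_P(X)=\sum_{\sim\triangleleft P}\frac{\mu_{P/\sim}}{cl(\sim)!}\,\alpha_{P|\sim}\,X^{cl(\sim)},\qquad ehr^{str}_P(X)=\sum_{\sim\triangleleft P}\frac{\mu_{P/\sim}}{cl(\sim)!}\,\alpha^{str}_{P|\sim}\,X^{cl(\sim)},$$ where $cl(\sim)$ is the number of equivalence classes of $\sim$.
   Context: $\mathbb{K}$ is a field of characteristic zero. A quasi-poset is a pair $P=(A,\leq_P)$ with $A$ finite and $\leq_P$ reflexive and transitive; $x\sim_Py$ means $x\leq_Py$ and $y\leq_Px$; $\overline{P}$ is the quotient poset on $A/\sim_P$, and $cl(P)$ is its cardinality; $\lfloor P\rfloor$ is the isoclass; $P_{\mid B}$ is the restriction to $B\subseteq A$; $top(P)$ is the topology of open sets, i.e. subsets $O$ with ($i\in O$, $i\leq_Pj$)$\Rightarrow j\in O$; $P$ is connected if this topology is connected. For an equivalence $\sim$ on $A$: $x\leq_{P|\sim}y$ iff $x\leq_Py$ and $x\sim y$; $\leq_{P/\sim}$ is the transitive closure of the relation ($x\leq_Py$ or $x\sim y$); these are quasi-posets $P|\sim$ and $P/\sim$ on $A$. We write $\sim\triangleleft P$ if the restriction of $P$ to each class of $\sim$ is connected and $\sim_{P/\sim}$ equals $\sim$. $\mathcal{H}_{\mathbf{qp}}$ is the $\mathbb{K}$-vector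 space with basis the set of isoclasses of quasi-posets, with product $m$ given by disjoint union (unit: empty quasi-poset), and coproducts $\Delta(\lfloor P\rfloor)=\sum_{O\in top(P)}\lfloor P_{\mid A\setminus O}\rfloor\otimes\lfloor P_{\mid O}\rfloor$ and $\delta(\lfloor P\rfloor)=\sum_{\sim\triangleleft P}\lfloor P/\sim\rfloor\otimes\lfloor P|\sim\rfloor$. $(\mathcal{H}_{\mathbf{qp}},m,\Delta)$ is a Hopf algebra, graded by $cl$; $(\mathcal{H}_{\mathbf{qp}},m,\delta)$ is a bialgebra. $\mathbb{K}[X]$ has its usual product, grading and coproduct $\Delta(X)=X\otimes1+1\otimes X$. $M_{\mathbf{qp}}$ is the set of characters (algebra morphisms to $\mathbb{K}$) of $\mathcal{H}_{\mathbf{qp}}$; for a character $\lambda$ write $\lambda_P=\lambda(\lfloor P\rfloor)$. For a Hopf algebra morphism $\phi:(\mathcal{H}_{\mathbf{qp}},m,\Delta)\to(\mathbb{K}[X],m,\Delta)$ and $\lambda\in M_{\mathbf{qp}}$, $\phi\leftarrow\lambda=(\phi\otimes\lambda)\circ\delta$. For $k\ge1$, $L_P(k)$ is the set of maps $f:A\to\{1,\ldots,k\}$ with $i\leq_Pj\Rightarrow f(i)\leq f(j)$, and $L^{str}_P(k)$ the set of $f\in L_P(k)$ such that ($i\leq_Pj$ and $f(i)=f(j)$)$\Rightarrow i\sim_Pj$. $ehr_P$, $ehr_P^{str}$ are the unique polynomials with $ehr_P(k)=\sharp L_P(k)$, $ehr_P^{str}(k)=\sharp L_P^{str}(k)$ for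 all $k\geq1$; $ehr,ehr^{str}:\mathcal{H}_{\mathbf{qp}}\to\mathbb{K}[X]$ are the corresponding linear maps (Hopf algebra morphisms for $\Delta$). $\phi_0$ is the unique homogeneous Hopf algebra morphism $(\mathcal{H}_{\mathbf{qp}},m,\Delta)\to(\mathbb{K}[X],m,\Delta)$ sending, for every $n\ge1$, the isoclass of the quasi-poset with $n$ pairwise equivalent elements to $X$. $\alpha,\alpha^{str}\in M_{\mathbf{qp}}$ are the unique characters with $ehr=\phi_0\leftarrow\alpha$ and $ehr^{str}=\phi_0\leftarrow\alpha^{str}$. $\mu_Q$ is the number of heap-orderings of a quasi-poset $Q$, i.e. the number of bijections $f:\overline{Q}\to\{1,\ldots,cl(Q)\}$ with $x\leq_{\overline Q}y\Rightarrow f(x)\leq f(y)$. *)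

(* Defs.v *)
From HB Require Import structures.
From mathcomp Require Import all_boot all_order all_algebra.
From mathcomp Require Import finmap monalg.

Set Implicit Arguments.
Unset Strict Implicit.
Unset Printing Implicit Defensive.

Import GRing.Theory.
Local Open Scope ring_scope.
Local Open Scope quotient_scope.

Record qposet := QPoset {
  qcar :> finType;
  qle : rel qcar;
  qle_refl : reflexive qle;
  qle_trans : transitive qle
}.
Arguments qle {q} x y.

Definition qsim (P : qposet) : rel P := fun x y => qle x y && qle y x.
Arguments qsim : clear implicits.

Definition qiso (P Q : qposet) : bool :=
  [exists f : {ffun P -> Q},
     [&& injectiveb f, f @: [set: P] == [set: Q]
       & [forall x, forall y, qle (f x) (f y) == qle x y]]].

Section Constructions.
Variable P : qposet.

Definition restr_le (B : {set P}) : rel {x : P | x \in B} :=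
  fun x y => qle (val x) (val y).
Fact restr_refl B : reflexive (restr_le (B := B)).
Proof. by move=> x; apply: qle_refl. Qed.
Fact restr_trans B : transitive (restr_le (B := B)).
Proof. by move=> y x z; apply: qle_trans. Qed.
Definition restr (B : {set P}) : qposet :=
  QPoset (@restr_refl B) (@restr_trans B).

Definition qopen (O : {set P}) : bool :=
  [forall i in O, forall j, qle i j ==> (j \in O)].

Definition qconnected : bool :=
  [forall O : {set P},
     qopen O && qopen (~: O) ==> (O == set0) || (O == [set: P])].

(* The quotient poset: its points are the classes of qsim, and the class B is *)
(* below the class C when some (equivalently, every) element of B is below    *)
(* some (equivalently, every) element of C.                                   *)
Definition qclasses : {set {set P}} :=
  equivalence_partition (qsim P) [set: P].
Definition qbar_le : rel {B : {set P} | B \in qclasses} :=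
  fun B C => [exists x in val B, exists y in val C, qle x y].

Fact qsim_equiv : {in [set: P] & &, equivalence_rel (qsim P)}.
Proof.
move=> x y z _ _ _; split; first by rewrite /qsim qle_refl.
move=> /andP[xy yx]; rewrite /qsim.
by apply/andP/andP => -[xz zx]; split;
  first [exact: qle_trans yx xz | exact: qle_trans zx xy
        |exact: qle_trans xy xz | exact: qle_trans zx yx].
Qed.

Fact qbar_refl : reflexive qbar_le.
Proof.
case=> B BP; have /and3P[_ _ B0] := equivalence_partitionP qsim_equiv.
have [x xB] : exists x, x \in B.
  by apply/set0Pn; apply: contraNneq B0 => <-.
by apply/exists_inP; exists x => //; apply/exists_inP; exists x => //;
  apply: qle_refl.
Qed.

Fact qbar_trans : transitive qbar_le.
Proof.
move=> [C CP] [B BP] [D DP] /exists_inP[x xB /exists_inP[y yC xy]].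
move=> /exists_inP[z zC /exists_inP[t tD zt]] /=.
apply/exists_inP; exists x => //; apply/exists_inP; exists t => //.
apply: qle_trans zt; apply: qle_trans xy _.
have /imsetP[u _ Eu] := CP; move: yC zC; rewrite /= Eu !inE /=.
by move=> /andP[_ yu] /andP[uz _]; apply: qle_trans uz.
Qed.

Definition qbar : qposet := QPoset qbar_refl qbar_trans.

Definition cl : nat := #|qbar|.

End Constructions.

(* Number of heap-orderings; {1, ..., cl Q} is shifted to 'I_(cl Q).          *)
Definition heap_num (Q : qposet) : nat :=
  #|[set f : {ffun qbar Q -> 'I_(cl Q)} |
      [&& injectiveb f, f @: [set: qbar Q] == [set: 'I_(cl Q)]
        & [forall x, forall y, qle x y ==> (f x <= f y)%N]]]|.

(* #L_P(k) and #L^str_P(k); {1, ..., k} is shifted to 'I_k.                   *)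
Definition lin_num (P : qposet) (k : nat) : nat :=
  #|[set f : {ffun P -> 'I_k} |
      [forall i, forall j, qle i j ==> (f i <= f j)%N]]|.
Definition strict_lin_num (P : qposet) (k : nat) : nat :=
  #|[set f : {ffun P -> 'I_k} |
      [forall i, forall j, qle i j ==> (f i <= f j)%N]
      && [forall i, forall j, qle i j && (f i == f j) ==> qsim P i j]]|.

Definition is_preorder (T : finType) (r : {set T * T}) : bool :=
  [forall x, (x, x) \in r] &&
  [forall x, forall y, forall z,
     ((x, y) \in r) && ((y, z) \in r) ==> ((x, z) \in r)].

Definition is_equiv (T : finType) (r : {set T * T}) : bool :=
  is_preorder r && [forall x, forall y, ((x, y) \in r) ==> ((y, x) \in r)].

Record eqv (T : finType) := Eqv {
  eqv_graph : {set T * T};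
  eqv_graphP : is_equiv eqv_graph
}.
HB.instance Definition _ (T : finType) := [isSub for @eqv_graph T].
HB.instance Definition _ (T : finType) := [Finite of eqv T by <:].

Definition eqv_rel (T : finType) (E : eqv T) : rel T :=
  fun x y => (x, y) \in eqv_graph E.
Coercion eqv_rel : eqv >-> rel.

Lemma is_preorderP (T : finType) (r : {set T * T}) :
  reflect (reflexive (fun x y => (x, y) \in r)
           /\ transitive (fun x y => (x, y) \in r)) (is_preorder r).
Proof.
apply: (iffP andP) => [[/forallP rr /forallP rt]|[rr rt]]; split => //.
- move=> y x z xy yz.
  by have /forallP/(_ y)/forallP/(_ z)/implyP := rt x; apply; rewrite xy.
- by apply/forallP.
- apply/forallP => x; apply/forallP => y; apply/forallP => z.
  by apply/implyP => /andP[]; apply: rt.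
Qed.

Lemma eqv_refl (T : finType) (E : eqv T) : reflexive E.
Proof. by have /andP[/is_preorderP[]] := eqv_graphP E. Qed.
Lemma eqv_trans (T : finType) (E : eqv T) : transitive E.
Proof. by have /andP[/is_preorderP[]] := eqv_graphP E. Qed.
Lemma eqv_sym (T : finType) (E : eqv T) x y : E x y -> E y x.
Proof. by have /andP[_ /forallP/(_ x)/forallP/(_ y)/implyP] := eqv_graphP E. Qed.

Definition ecl (T : finType) (E : eqv T) : nat :=
  #|equivalence_partition E [set: T]|.

(* For an equivalence ~ on P given by E: qsub E is P | ~, qquo E is P / ~ and *)
(* compat E is the relation ~ <| P.                                           *)
Section Contraction.
Variable P : qposet.

Definition qsub_le (E : eqv P) : rel P := fun x y => qle x y && E x y.
Fact qsub_refl E : reflexive (qsub_le E).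
Proof. by move=> x; rewrite /qsub_le qle_refl eqv_refl. Qed.
Fact qsub_trans E : transitive (qsub_le E).
Proof.
move=> y x z /andP[xy exy] /andP[yz eyz].
by rewrite /qsub_le (qle_trans xy yz) (eqv_trans exy eyz).
Qed.
Definition qsub (E : eqv P) : qposet := QPoset (@qsub_refl E) (@qsub_trans E).

(* connect is the reflexive transitive closure, which is the transitive       *)
(* closure here since the relation is already reflexive.                      *)
Definition qquo_le (E : eqv P) : rel P :=
  connect [rel x y | qle x y || E x y].
Fact qquo_refl E : reflexive (qquo_le E).
Proof. exact: connect0. Qed.
Fact qquo_trans E : transitive (qquo_le E).
Proof. exact: connect_trans. Qed.
Definition qquo (E : eqv P) : qposet := QPoset (@qquo_refl E) (@qquo_trans E).

Definition compat (E : eqv P) : bool :=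
  [forall x, qconnected (restr [set y | E x y])] &&
  [forall x, forall y, qsim (qquo E) x y == E x y].

End Contraction.

Definition union_le (P Q : qposet) : rel (P + Q)%type := fun x y =>
  match x, y with
  | inl a, inl b => qle a b
  | inr a, inr b => qle a b
  | _, _ => false
  end.
Fact union_refl P Q : reflexive (union_le (P := P) (Q := Q)).
Proof. by case=> x; apply: qle_refl. Qed.
Fact union_trans P Q : transitive (union_le (P := P) (Q := Q)).
Proof. by move=> [y|y] [x|x] [z|z] //; apply: qle_trans. Qed.
Definition qunion (P Q : qposet) : qposet :=
  QPoset (@union_refl P Q) (@union_trans P Q).

(* n pairwise equivalent elements; indisc 0 is the empty quasi-poset.         *)
Fact indisc_refl n : reflexive (fun _ _ : 'I_n => true). Proof. by []. Qed.
Fact indisc_trans n : transitive (fun _ _ : 'I_n => true). Proof. by []. Qed.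
Definition indisc (n : nat) : qposet :=
  QPoset (@indisc_refl n) (@indisc_trans n).

Lemma qisoP (P Q : qposet) :
  reflect (exists2 f : P -> Q, bijective f & {mono f : x y / qle x y})
          (qiso P Q).
Proof.
apply: (iffP existsP) => [[f /and3P[/injectiveP fi /eqP fs /forallP fm]]|].
  exists f; last by move=> x y; have /forallP/(_ y)/eqP := fm x.
  apply: inj_card_bij => //.
  by rewrite -!cardsT -fs card_imset.
case=> f [g fK gK] fm; exists (finfun f); apply/and3P; split.
- by apply/injectiveP => x y; rewrite !ffunE => /(can_inj fK).
- apply/eqP/setP => y; rewrite inE; apply/imsetP; exists (g y) => //.
  by rewrite ffunE gK.
- by apply/forallP => x; apply/forallP => y; rewrite !ffunE fm.
Qed.

Lemma qiso_refl : reflexive qiso.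
Proof. by move=> P; apply/qisoP; exists id => //; exists id. Qed.

Lemma qiso_sym : symmetric qiso.
Proof.
suff H P Q : qiso P Q -> qiso Q P by move=> P Q; apply/idP/idP; apply: H.
move=> /qisoP[f [g fK gK] fm]; apply/qisoP; exists g; first by exists f.
by move=> x y; rewrite -fm !gK.
Qed.

Lemma qiso_trans : transitive qiso.
Proof.
move=> Q P R /qisoP[f fb fm] /qisoP[g gb gm]; apply/qisoP; exists (g \o f).
  exact: bij_comp.
by move=> x y /=; rewrite gm fm.
Qed.

(* Quasi-posets on {0, ..., n-1}: every finite quasi-poset is isomorphic to   *)
(* one of these, and they form a choiceType.                                  *)
Definition qcode := {n : nat & {r : {set 'I_n * 'I_n} | is_preorder r}}.
HB.instance Definition _ := Choice.on qcode.

Definition of_qcode (c : qcode) : qposet :=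
  QPoset (is_preorderP _ (valP (tagged c))).1
         (is_preorderP _ (valP (tagged c))).2.

Fact to_qcode_subproof (P : qposet) :
  is_preorder [set p : 'I_#|P| * 'I_#|P| |
                qle (enum_val p.1 : P) (enum_val p.2)].
Proof.
apply/is_preorderP; split=> [x|y x z]; rewrite !inE /=; first exact: qle_refl.
exact: qle_trans.
Qed.
Definition to_qcode (P : qposet) : qcode :=
  Tagged (fun n => {r : {set 'I_n * 'I_n} | is_preorder r})
    (Sub _ (to_qcode_subproof P) : {r : {set _} | is_preorder r}).

Lemma to_qcodeK (P : qposet) : qiso (of_qcode (to_qcode P)) P.
Proof.
apply/qisoP; exists (enum_val : 'I_#|P| -> P); first exact: enum_val_bij.
by move=> x y; rewrite [RHS]/qle /= inE.
Qed.

Definition qcode_iso : rel qcode := fun c d => qiso (of_qcode c) (of_qcode d).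
Fact qcode_iso_refl : reflexive qcode_iso.
Proof. by move=> c; apply: qiso_refl. Qed.
Fact qcode_iso_sym : symmetric qcode_iso.
Proof. by move=> c d; apply: qiso_sym. Qed.
Fact qcode_iso_trans : transitive qcode_iso.
Proof. by move=> d c e; apply: qiso_trans. Qed.
Canonical qcode_iso_equiv :=
  EquivRel qcode_iso qcode_iso_refl qcode_iso_sym qcode_iso_trans.

Definition isoclass := {eq_quot qcode_iso}.
HB.instance Definition _ := Choice.on isoclass.
HB.instance Definition _ := EqQuotient.on isoclass.

Definition isocl (P : qposet) : isoclass := \pi_{eq_quot qcode_iso} (to_qcode P).
Definition irepr (c : isoclass) : qposet := of_qcode (repr c).

Lemma isocl_eq (P Q : qposet) : (isocl P == isocl Q) = qiso P Q.
Proof.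
rewrite /isocl eqmodE /= /qcode_iso; apply/idP/idP => H.
  apply: qiso_trans (to_qcodeK Q); apply: qiso_trans H.
  by rewrite qiso_sym to_qcodeK.
apply: (qiso_trans (to_qcodeK P)); apply: (qiso_trans H).
by rewrite qiso_sym to_qcodeK.
Qed.

Lemma ireprK : cancel irepr isocl.
Proof.
move=> c; rewrite -[RHS]reprK; apply/eqP.
by rewrite /isocl eqmodE; apply: to_qcodeK.
Qed.

Lemma irepr_isocl (P : qposet) : qiso (irepr (isocl P)) P.
Proof. by rewrite -isocl_eq ireprK. Qed.

Definition imul (c d : isoclass) : isoclass :=
  isocl (qunion (irepr c) (irepr d)).
Definition ione : isoclass := isocl (indisc 0).

Lemma qiso_union (P P' Q Q' : qposet) :
  qiso P P' -> qiso Q Q' -> qiso (qunion P Q) (qunion P' Q').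
Proof.
move=> /qisoP[f [f' fK fK'] fm] /qisoP[g [g' gK gK'] gm].
apply/qisoP; exists (fun x : qunion P Q => match x with
  | inl a => inl (f a) | inr b => inr (g b) end : qunion P' Q').
  by exists (fun x : qunion P' Q' => match x with
    | inl a => inl (f' a) | inr b => inr (g' b) end : qunion P Q);
  case=> x; rewrite ?fK ?gK ?fK' ?gK'.
by case=> x [] y //; [apply: fm|apply: gm].
Qed.

Lemma isocl_union (P Q : qposet) :
  isocl (qunion P Q) = imul (isocl P) (isocl Q).
Proof.
apply/eqP; rewrite isocl_eq; apply: qiso_union; rewrite qiso_sym;
exact: irepr_isocl.
Qed.

Fact imulA : associative imul.
Proof.
move=> c d e; rewrite -(ireprK c) -(ireprK d) -(ireprK e) -!isocl_union.
apply/eqP; rewrite isocl_eq; set P := irepr c; set Q := irepr d.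
set R := irepr e; apply/qisoP.
exists (fun x : qunion P (qunion Q R) => match x with
  | inl a => inl (inl a) | inr (inl b) => inl (inr b)
  | inr (inr b) => inr b end : qunion (qunion P Q) R).
  by exists (fun x : qunion (qunion P Q) R => match x with
    | inl (inl a) => inl a | inl (inr b) => inr (inl b)
    | inr b => inr (inr b) end : qunion P (qunion Q R)); case=> [|[]] // [].
by case=> [x|[x|x]] [y|[y|y]].
Qed.

Fact imulC : commutative imul.
Proof.
move=> c d; rewrite -(ireprK c) -(ireprK d) -!isocl_union.
apply/eqP; rewrite isocl_eq; set P := irepr c; set Q := irepr d.
apply/qisoP; exists (fun x : qunion P Q => match x with
  | inl a => inr a | inr b => inl b end : qunion Q P).
  by exists (fun x : qunion Q P => match x with
    | inl a => inr a | inr b => inl b end : qunion P Q); case.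
by case=> x [].
Qed.

Fact imul1m : left_id ione imul.
Proof.
move=> c; rewrite -(ireprK c) -!isocl_union.
apply/eqP; rewrite isocl_eq qiso_sym; apply/qisoP.
exists (inr : irepr c -> qunion (indisc 0) (irepr c)) => //.
exists (fun x : qunion (indisc 0) (irepr c) => match x with
  | inl (Ordinal i i0) => match notF (etrans (esym (ltn0 i)) i0) return _ with end
  | inr b => b end) => //.
by case=> // -[].
Qed.

Fact imulm1 : right_id ione imul.
Proof. by move=> c; rewrite imulC imul1m. Qed.

Lemma qiso_card (P Q : qposet) : qiso P Q -> #|P| = #|Q|.
Proof. by move=> /qisoP[f /bij_eq_card]. Qed.

Lemma isocl_eq1 (P : qposet) : (isocl P == ione) = (#|P| == 0%N).
Proof.
rewrite isocl_eq; apply/idP/eqP => [/qiso_card->|P0]; first exact: card_ord.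
apply/qisoP; have F x : x \in P -> False.
  by move=> _; move: (card0_eq P0 x); rewrite !inE.
exists (fun x : P => match F x isT with end : indisc 0).
  by exists (fun x : indisc 0 => match x with Ordinal i i0 =>
      match notF (etrans (esym (ltn0 i)) i0) return P with end end)
   => x; [case: (F x isT)|case: x].
by move=> x; case: (F x isT).
Qed.

Fact imul_unit c d : imul c d = ione -> c = ione /\ d = ione.
Proof.
rewrite -(ireprK c) -(ireprK d) -isocl_union => /eqP.
rewrite isocl_eq1 card_sum addn_eq0 => /andP[c0 d0].
by split; apply/eqP; rewrite isocl_eq1.
Qed.

HB.instance Definition _ := Choice_isMonomialDef.Build isoclass
  imulA imul1m imulm1 imul_unit.
HB.instance Definition _ := MonomialDef_isConomialDef.Build isoclass imulC.

(* H_qp is the monoid algebra of the isoclasses under disjoint union, and     *)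
(* H_qp (x) H_qp is the free module on pairs of isoclasses.                   *)
Notation Hqp K := {malg K[isoclass]}.
Notation Hqp2 K := {malg K[(isoclass * isoclass)%type]}.

Definition cls (K : fieldType) (P : qposet) : Hqp K := << isocl P >>.
Arguments cls : clear implicits.

Section LinearExtension.
Variables (K : fieldType) (I : choiceType) (V : lmodType K) (f : I -> V).

Definition lext (g : {malg K[I]}) : V := \sum_(k <- msupp g) g@_k *: f k.

Lemma lextEw (d : {fset I}) g : (msupp g `<=` d)%fset ->
  lext g = \sum_(k <- d) g@_k *: f k.
Proof.
move=> le; rewrite /lext (big_fset_incl _ le) //= => k _ /mcoeff_outdom ->.
by rewrite scale0r.
Qed.

Fact lext_linear : linear lext.
Proof.
move=> a g h; set d := (msupp g `|` msupp h `|` msupp (a *: g + h))%fset.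
rewrite !(@lextEw d) ?fsubsetUr //; first last.
- by rewrite /d -fsetUA fsubsetUl.
- by rewrite /d fsetUAC fsubsetUr.
rewrite scaler_sumr -big_split /=; apply: eq_bigr => k _.
by rewrite mcoeffD mcoeffZ scalerDl scalerA.
Qed.
HB.instance Definition _ :=
  GRing.isLinear.Build K {malg K[I]} V *:%R lext lext_linear.

Lemma lextU k : lext << k >> = f k.
Proof.
by rewrite (lextEw (d := [fset k]%fset)) ?msuppU_le // big_seq_fset1 mcoeffUU scale1r.
Qed.
End LinearExtension.

Definition Delta (K : fieldType) : Hqp K -> Hqp2 K :=
  lext (fun c : isoclass => \sum_(O : {set irepr c} | qopen O)
          << (isocl (restr (~: O)), isocl (restr O)) >> : Hqp2 K).

Definition delta (K : fieldType) : Hqp K -> Hqp2 K :=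
  lext (fun c : isoclass => \sum_(E : eqv (irepr c) | compat E)
          << (isocl (qquo E), isocl (qsub E)) >> : Hqp2 K).

Definition counit (K : fieldType) (x : Hqp K) : K := x@_(isocl (indisc 0)).

(* phi <- lambda = (phi (x) lambda) o delta                                   *)
Definition act (K : fieldType) (phi : Hqp K -> {poly K}) (lambda : Hqp K -> K)
    (x : Hqp K) : {poly K} :=
  lext (fun cd : isoclass * isoclass => lambda << cd.2 >> *: phi << cd.1 >>)
    (delta x).

(* K[X] (x) K[X] is identified with {poly {poly K}}, with X (x) 1 = 'X and    *)
(* 1 (x) X = 'X%:P; a scalar of K is then a constant of constants.            *)
Definition ptensor (K : fieldType) (p q : {poly K}) : {poly {poly K}} :=
  map_poly polyC p * q%:P.
Definition pDelta (K : fieldType) (p : {poly K}) : {poly {poly K}} :=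
  map_poly polyC p \Po ('X + 'X%:P).

Definition tensor_map (K : fieldType) (phi psi : Hqp K -> {poly K}) :
    Hqp2 K -> {poly {poly K}} :=
  mmap (polyC \o polyC)
    (fun cd : isoclass * isoclass => ptensor (phi << cd.1 >>) (psi << cd.2 >>)).

(* No condition on the antipodes is needed: a bialgebra morphism between Hopf *)
(* algebras commutes with them.                                               *)
Definition hopf_morphism (K : fieldType)
    (phi : {lrmorphism Hqp K -> {poly K}}) : Prop :=
  (forall x, pDelta (phi x) = tensor_map phi phi (Delta x))
  /\ (forall x, (phi x).[0] = counit x).

(* Homogeneous of degree 0, for the grading of H_qp by cl.                    *)
Definition homogeneous (K : fieldType) (phi : Hqp K -> {poly K}) : Prop :=
  forall n x, (forall c, c \in msupp x -> cl (irepr c) = n) ->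
    exists a : K, phi x = a *: 'X^n.

Lemma clsM (K : fieldType) (P Q : qposet) :
  cls K (qunion P Q) = cls K P * cls K Q.
Proof. by rewrite /cls isocl_union malgM_def fgmulUU mulr1. Qed.

Lemma cls_empty (K : fieldType) : cls K (indisc 0) = 1.
Proof. by []. Qed.

Section Transport.
Variables (P Q : qposet) (f : P -> Q) (g : Q -> P).
Hypotheses (fK : cancel f g) (gK : cancel g f).
Hypothesis f_mono : {mono f : x y / qle x y}.

Let f_inj : injective f := can_inj fK.

Fact imset_canE (B : {set P}) y : (y \in f @: B) = (g y \in B).
Proof. by rewrite -{1}(gK y) mem_imset. Qed.

Lemma qiso_restr (B : {set P}) : qiso (restr B) (restr (f @: B)).
Proof.
apply/qisoP.
have gB (y : restr (f @: B)) : g (val y) \in B by rewrite -imset_canE (valP y).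
exists (fun x : restr B =>
  Sub (f (val x)) (imset_f f (valP x)) : restr (f @: B)).
  exists (fun y : restr (f @: B) => Sub (g (val y)) (gB y) : restr B) => x;
  by apply: val_inj => /=; rewrite ?fK ?gK.
by move=> x y; rewrite /qle /= /restr_le /= f_mono.
Qed.

Lemma qopen_imset (O : {set P}) : qopen (f @: O) = qopen O.
Proof.
apply/forall_inP/forall_inP => H i iO; apply/forallP => j; apply/implyP => ij.
  have /forallP/(_ (f j))/implyP := H (f i) (imset_f f iO).
  by rewrite f_mono mem_imset //; apply.
move: iO; rewrite !imset_canE => iO.
have /forallP/(_ (g j))/implyP H' := H _ iO.
by apply: H'; rewrite -f_mono !gK.
Qed.

Lemma imset_setC (O : {set P}) : f @: (~: O) = ~: (f @: O).
Proof. by apply/setP => y; rewrite inE !imset_canE inE. Qed.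

Lemma imset_bij : bijective (fun O : {set P} => f @: O).
Proof.
exists (fun O : {set Q} => g @: O) => O; rewrite -imset_comp -[RHS]imset_id;
by apply: eq_imset => x /=; rewrite ?fK ?gK.
Qed.

Lemma qconnected_iso : qconnected P = qconnected Q.
Proof.
have [h hK Kh] := imset_bij.
have H O : [&& qopen O & qopen (~: O)] ==> (O == set0) || (O == [set: P])
         = [&& qopen (f @: O) & qopen (~: (f @: O))] ==>
             (f @: O == set0) || (f @: O == [set: Q]).
  rewrite -imset_setC !qopen_imset imset_eq0; congr (_ ==> (_ || _)).
  rewrite -(inj_eq (can_inj hK)); congr (_ == _); apply/setP => y.
  by rewrite imset_canE !inE.
apply/forallP/forallP => C O; last by rewrite H.
by rewrite -[O]Kh -H.
Qed.

Fact pull_subproof (T U : finType) (h : T -> U) (E : eqv U) :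
  is_equiv [set p : T * T | E (h p.1) (h p.2)].
Proof.
apply/andP; split.
  by apply/is_preorderP; split=> [x|y x z]; rewrite !inE /=;
    [exact: eqv_refl | exact: eqv_trans].
apply/forallP => x; apply/forallP => y; apply/implyP; rewrite !inE /=.
exact: eqv_sym.
Qed.
Definition pull (T U : finType) (h : T -> U) (E : eqv U) : eqv T :=
  Eqv (pull_subproof h E).
Lemma pullE (T U : finType) (h : T -> U) (E : eqv U) x y :
  pull h E x y = E (h x) (h y).
Proof. by rewrite [LHS]inE. Qed.

Lemma qiso_qsub (E : eqv P) : qiso (qsub E) (qsub (pull g E)).
Proof.
apply/qisoP; exists (f : qsub E -> qsub (pull g E)); first by exists g.
by move=> x y; rewrite /qle /= /qsub_le f_mono pullE !fK.
Qed.

Lemma qquo_mono (E : eqv P) :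
  {mono f : x y / @qle (qquo E) x y >-> @qle (qquo (pull g E)) x y}.
Proof.
move=> x y; rewrite /qle /= /qquo_le; apply/connectP/connectP => -[p pP py].
  exists (map g p); last by rewrite -[x]fK last_map -py fK.
  rewrite -[x]fK path_map; apply: sub_path pP => u v /=.
  by rewrite pullE -f_mono !gK.
exists (map f p); last by rewrite last_map -py.
rewrite path_map; apply: sub_path pP => u v /=.
by rewrite pullE f_mono !fK.
Qed.

Lemma qiso_qquo (E : eqv P) : qiso (qquo E) (qquo (pull g E)).
Proof.
apply/qisoP; exists (f : qquo E -> qquo (pull g E)); first by exists g.
exact: qquo_mono.
Qed.

End Transport.

Lemma qiso_connected (P Q : qposet) : qiso P Q -> qconnected P = qconnected Q.
Proof. by move=> /qisoP[f [g fK gK] fm]; apply: qconnected_iso fK gK fm. Qed.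

Lemma compat_pull (P Q : qposet) (f : P -> Q) (g : Q -> P) (E : eqv P) :
  cancel f g -> cancel g f -> {mono f : x y / qle x y} ->
  compat (pull g E) = compat E.
Proof.
move=> fK gK fm; congr andb.
  have H x : qconnected (restr [set y | E x y])
           = qconnected (restr [set y | pull g E (f x) y]).
    rewrite (qiso_connected (qiso_restr fK gK fm _)); congr (qconnected (restr _)).
    by apply/setP => y; rewrite (imset_canE fK gK) !inE pullE fK.
  by apply/forallP/forallP => C x; [rewrite H | rewrite -[x]gK -H].
have H x y : (qsim (qquo E) x y == E x y)
           = (qsim (qquo (pull g E)) (f x) (f y) == pull g E (f x) (f y)).
  by rewrite /qsim !(qquo_mono fK gK fm) pullE !fK.
apply/forallP/forallP => C x; apply/forallP => y.
  by rewrite H; have /forallP := C (f x).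
by rewrite -[x]gK -[y]gK -H; have /forallP := C (g x).
Qed.

Lemma DeltaE (K : fieldType) (P : qposet) :
  Delta (cls K P) =
    \sum_(O : {set P} | qopen O)
       << (isocl (restr (~: O)), isocl (restr O)) >> :> Hqp2 K.
Proof.
rewrite /Delta lextU.
have /qisoP[f [g fK gK] fm] := irepr_isocl P.
have ibij := imset_bij fK gK.
rewrite [RHS](reindex _ (onW_bij _ ibij)) /=.
apply: eq_big => [O|O _]; first by rewrite (qopen_imset fK gK fm).
rewrite -(imset_setC fK gK).
by congr << (_, _) >>; apply/eqP; rewrite isocl_eq; apply: (qiso_restr fK gK fm).
Qed.

Lemma deltaE (K : fieldType) (P : qposet) :
  delta (cls K P) =
    \sum_(E : eqv P | compat E)
       << (isocl (qquo E), isocl (qsub E)) >> :> Hqp2 K.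
Proof.
rewrite /delta lextU.
have /qisoP[f [g fK gK] fm] := irepr_isocl P.
have pbij : bijective (pull g).
  exists (pull f) => E; apply: val_inj; apply/setP => -[x y]; rewrite !inE /=;
  by rewrite [LHS]pullE ?fK ?gK.
rewrite [RHS](reindex _ (onW_bij _ pbij)) /=.
apply: eq_big => [E|E _]; first by rewrite (compat_pull _ fK gK fm).
congr << (_, _) >>; apply/eqP; rewrite isocl_eq.
  exact: (qiso_qquo fK gK fm).
exact: (qiso_qsub fK gK fm).
Qed.

(* Main.v *)
Require Import Defs.
From mathcomp Require Import all_boot all_order all_algebra.
From mathcomp Require Import finmap monalg.

Set Implicit Arguments.
Unset Strict Implicit.
Unset Printing Implicit Defensive.

Import GRing.Theory.
Local Open Scope ring_scope.

(** Since ehr = phi0 <- alpha and ehr_str = phi0 <- alpha_str, everything rests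
    on the values of phi0:
      phi0 P = heap_num P / (cl P)! * X^(cl P)        (lemma [phi0_heap]).
    Homogeneity gives phi0 P = a_P X^n with n = cl P. As phi0 respects the
    coproducts,
      a_P (X (x) 1 + 1 (x) X)^n
        = sum_(O open) a_(P minus O) a_O X^(n - cl O) (x) X^(cl O),
    and the coefficients of X^(n-1) (x) X give
      n a_P = sum_(O open, cl O = 1) a_(P minus O)    (lemma [coefcl_rec]),
    because a one-class quasi-poset is sent to X. These O are the maximal
    classes of P. A heap-ordering of P is a choice of the class that receives
    the largest label, necessarily a maximal one, and a heap-ordering of the
    rest, so heap_num satisfies the same recursion without the factor n
    (lemma [heap_num_rec]), and a_P = heap_num P / n! by induction on n.

    The formulas for ehr and ehr_str then come from expanding
    (phi0 (x) alpha) o delta (lemma [act_heap]). The derivative at 0 is the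
    coefficient of X, to which only the compatible equivalences with a single
    class contribute; the only one is the full relation, which is compatible
    when P is connected and for which P | ~ is P itself (lemma [coef1_act]).

    Heap-orderings are handled through the maps P -> {0, ..., n-1} that they
    induce on the points of P (definition [labelings]); this avoids relating
    the quotient poset of a restriction to that of P. *)

(** * Number of classes *)

(** Used in both directions, this lets the classes be counted with any map whose
    fibres they are. *)
Lemma leq_card_imset_kernel (S T U : finType) (f : S -> T) (g : S -> U)
    (A : {set S}) :
  {in A &, forall x y, f x = f y -> g x = g y} -> (#|g @: A| <= #|f @: A|)%N.
Proof.
move=> fg; have someI : injective (@Some U) by move=> u v [].
rewrite -(card_imset _ someI).
pose h u := omap g [pick x in A | f x == u].
suff /subset_leq_card/leq_trans : Some @: (g @: A) \subset h @: (f @: A).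
  by apply; apply: leq_imset_card.
apply/subsetP => _ /imsetP[_ /imsetP[x xA ->] ->].
apply/imsetP; exists (f x); first exact: imset_f.
rewrite /h; case: pickP => [y /andP[yA /eqP fy]|/(_ x)] /=.
  by congr Some; apply: fg.
by rewrite xA eqxx.
Qed.

Definition qclass (P : qposet) (x : P) : {set P} := [set y | qsim P x y].

Lemma qclass_eq (P : qposet) (x y : P) : (qclass x == qclass y) = qsim P x y.
Proof.
apply/eqP/idP => [/setP/(_ y)|xy]; first by rewrite !inE /qsim qle_refl => ->.
apply/setP => z; rewrite !inE.
exact: (qsim_equiv (in_setT x) (in_setT y) (in_setT z)).2 xy.
Qed.

Lemma clE (P : qposet) : cl P = #|(@qclass P) @: [set: P]|.
Proof.
rewrite /cl card_sub; apply: eq_card => B; rewrite inE.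
rewrite /qclasses /equivalence_partition; apply/imsetP/imsetP => -[x _ ->];
  by exists x => //; apply/setP => y; rewrite !inE.
Qed.

Lemma cl_imset (P : qposet) (T : finType) (f : P -> T) :
  (forall x y, (f x == f y) = qsim P x y) -> cl P = #|f @: [set: P]|.
Proof.
move=> fP; rewrite clE; apply/eqP; rewrite eqn_leq.
by apply/andP; split; apply: leq_card_imset_kernel => x y _ _ /eqP;
  rewrite ?fP -?qclass_eq => H; apply/eqP => //; rewrite fP -qclass_eq.
Qed.

Lemma cl_iso (P Q : qposet) : qiso P Q -> cl P = cl Q.
Proof.
move=> /qisoP[f [g fK gK] fm]; rewrite [cl Q]clE.
rewrite (@cl_imset P _ (fun x => qclass (f x))) => [|x y]; last first.
  by rewrite qclass_eq /qsim !fm.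
congr #|pred_of_set _|; apply/setP => B; apply/imsetP/imsetP => -[x _ ->].
  by exists (f x).
by exists (g x); rewrite ?gK.
Qed.

(** Classes of a restriction are counted by the full classes of [P] that meet
    [B]; in this form they can be compared for different [B]. *)
Lemma cl_restr (P : qposet) (B : {set P}) : cl (restr B) = #|(@qclass P) @: B|.
Proof.
rewrite (@cl_imset (restr B) _ (fun x => qclass (val x))) => [|x y]; last first.
  by rewrite qclass_eq.
congr #|pred_of_set _|; apply/setP => C; apply/imsetP/imsetP => -[x xB ->].
  by exists (val x) => //; apply: valP.
by exists (Sub x xB).
Qed.

Lemma qopenP (P : qposet) (O : {set P}) :
  reflect (forall x y, x \in O -> qle x y -> y \in O) (qopen O).
Proof.
apply: (iffP forall_inP) => H x; last first.
  by move=> xO; apply/forallP => y; apply/implyP; apply: H.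
by move=> y xO; have /forallP/(_ y)/implyP := H x xO.
Qed.

(** An open set is a union of classes, hence no class meets both [O] and its
    complement. *)
Lemma cl_restrC (P : qposet) (O : {set P}) : qopen O ->
  cl P = (cl (restr (~: O)) + cl (restr O))%N.
Proof.
move=> /qopenP Oop; rewrite clE !cl_restr -cardsUI -imsetU setUC setUCr.
suff -> : qclass (P := P) @: (~: O) :&: qclass (P := P) @: O = set0.
  by rewrite cards0 addn0.
apply/setP => C; rewrite !inE; apply/andP => -[/imsetP[x xO ->] /imsetP[y yO]].
move=> /eqP; rewrite qclass_eq => /andP[_ yx].
by move: xO; rewrite inE (Oop y x).
Qed.

Lemma cl_eq0 (P : qposet) : (cl P == 0%N) = (#|P| == 0%N).
Proof. by rewrite clE cards_eq0 imset_eq0 -cards_eq0 cardsT. Qed.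

Lemma cl_eq1P (P : qposet) :
  reflect ((0 < #|P|)%N /\ forall x y : P, qsim P x y) (cl P == 1%N).
Proof.
rewrite clE; apply: (iffP cards1P) => [[C PC]|[/card_gt0P[x _] sim]].
  have PC' x : qclass x = C by apply/set1P; rewrite -PC imset_f.
  split=> [|x y]; last by rewrite -qclass_eq !PC'.
  rewrite lt0n -cardsT cards_eq0 -(imset_eq0 (@qclass P)) PC.
  by apply/set0Pn; exists C; rewrite set11.
exists (qclass x); apply/setP => D; rewrite !inE; apply/imsetP/eqP => [[y _ ->]|->].
  by apply/eqP; rewrite qclass_eq.
by exists x.
Qed.

Lemma isocl_indisc (P : qposet) : (forall x y : P, qle x y) ->
  isocl P = isocl (indisc #|P|).
Proof.
move=> sim; apply/eqP; rewrite isocl_eq; apply/qisoP.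
exists (enum_rank : P -> indisc #|P|); first exact: enum_rank_bij.
by move=> x y; rewrite sim.
Qed.

Lemma isocl_cl1 (P : qposet) : cl P = 1%N ->
  exists2 n, (0 < n)%N & isocl P = isocl (indisc n).
Proof.
move=> /eqP/cl_eq1P[P0 sim]; exists #|P| => //.
by apply: isocl_indisc => x y; have /andP[] := sim x y.
Qed.

(** * Heap-orderings as labelings of the points *)

(** The maps that factor through the quotient poset as an injective monotone
    map: monotonicity already makes them constant on classes. *)
Definition labelings (P : qposet) (n : nat) : {set {ffun P -> 'I_n}} :=
  [set f : {ffun P -> 'I_n} | [forall x, forall y,
     (qle x y ==> (f x <= f y)%N) && ((f x == f y) ==> qsim P x y)]].

Lemma labelingsP (P : qposet) n (f : {ffun P -> 'I_n}) :
  reflect ((forall x y, qle x y -> (f x <= f y)%N)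
           /\ (forall x y, (f x == f y) = qsim P x y)) (f \in labelings P n).
Proof.
rewrite inE; apply: (iffP forallP) => [H|[Hle Hsim] x].
  have Hle x y : qle x y -> (f x <= f y)%N.
    by have /forallP/(_ y)/andP[/implyP] := H x.
  split=> // x y; apply/idP/andP => [|[xy yx]].
    by have /forallP/(_ y)/andP[_ /implyP f_sim /f_sim/andP] := H x.
  by rewrite -(inj_eq val_inj) eqn_leq !Hle.
apply/forallP => y; rewrite Hsim implybb andbT; exact/implyP/Hle.
Qed.

Lemma mem_qclasses (P : qposet) (B : {set P}) :
  reflect (exists x, B = qclass x) (B \in qclasses P).
Proof.
have eqC (x : P) : qclass x = [set y in [set: P] | qsim P x y].
  by apply/setP => y; rewrite !inE.
by apply: (iffP imsetP) => [[x _ ->]|[x ->]]; exists x; rewrite // eqC.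
Qed.

Lemma qclass_mem (P : qposet) (x : P) : qclass x \in qclasses P.
Proof. by apply/mem_qclasses; exists x. Qed.

Definition qproj (P : qposet) (x : P) : qbar P := Sub (qclass x) (qclass_mem x).

Lemma qproj_eq (P : qposet) (x y : P) : (qproj x == qproj y) = qsim P x y.
Proof. by rewrite -val_eqE /= qclass_eq. Qed.

Lemma qproj_le (P : qposet) (x y : P) : qle (qproj x) (qproj y) = qle x y.
Proof.
apply/exists_inP/idP => [[u]|xy].
  rewrite inE => /andP[xu _] /exists_inP[v]; rewrite inE => /andP[_ vy] uv.
  exact: qle_trans (qle_trans xu uv) vy.
exists x; first by rewrite inE /qsim qle_refl.
by apply/exists_inP; exists y; rewrite // inE /qsim qle_refl.
Qed.

Lemma qproj_surj (P : qposet) (B : qbar P) : exists x, qproj x == B.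
Proof. by have /mem_qclasses[x Bx] := valP B; exists x; rewrite -val_eqE Bx. Qed.

(** Composition with the projection [qproj] is the bijection; surjectivity of a
    heap-ordering is automatic, being an injection between sets of the same
    size. *)
Lemma heap_num_labelings (P : qposet) : heap_num P = #|labelings P (cl P)|.
Proof.
pose h (g : {ffun qbar P -> 'I_(cl P)}) := [ffun x => g (qproj x)].
rewrite /heap_num -(card_imset _ (f := h)) => [|g1 g2 /ffunP g12]; last first.
  apply/ffunP => B; have [x /eqP <-] := qproj_surj B.
  by have := g12 x; rewrite !ffunE.
apply: eq_card => f; apply/imsetP/labelingsP => [[g]|[fle fsim]].
  rewrite inE => /and3P[/injectiveP gi _ /forallP gle] ->.
  split=> x y; rewrite !ffunE; last by rewrite (inj_eq gi) qproj_eq.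
  by rewrite -qproj_le; have /forallP/(_ (qproj y))/implyP := gle (qproj x).
pose s (B : qbar P) := xchoose (qproj_surj B).
have sK B : qproj (s B) = B by apply/eqP; exact: (xchooseP (qproj_surj B)).
have gi : injective (fun B => f (s B)).
  by move=> B C /eqP; rewrite fsim -qproj_eq !sK => /eqP.
exists [ffun B => f (s B)]; last first.
  by apply/ffunP => x; rewrite !ffunE; apply/eqP; rewrite fsim -qproj_eq sK.
have gi' : injective [ffun B => f (s B)].
  by move=> B C; rewrite !ffunE; apply: gi.
rewrite inE; apply/and3P; split; first by apply/injectiveP.
  by rewrite eqEcard subsetT cardsT card_ord card_imset // cardsT; apply: leqnn.
apply/forallP => B; apply/forallP => C; apply/implyP => BC.
by rewrite !ffunE fle // -qproj_le !sK.
Qed.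

(** * Removing the class with the largest label *)

Section Extension.
Variables (P : qposet) (n : nat) (O : {set P}).

(** Inverse of the removal of the block [O] of points with the largest label. *)
Definition add_top (g : {ffun restr (~: O) -> 'I_n}) : {ffun P -> 'I_n.+1} :=
  [ffun x => if insub x is Some u then widen_ord (leqnSn n) (g u) else ord_max].

Lemma add_top_out g (u : restr (~: O)) : add_top g (val u) = g u :> nat.
Proof. by rewrite ffunE valK. Qed.

Lemma add_top_max g x : (add_top g x == ord_max) = (x \in O).
Proof.
rewrite ffunE; case: insubP => [u xO _|].
  by rewrite -val_eqE /= (ltn_eqF (ltn_ord _)); move: xO; rewrite inE => /negPf.
by rewrite eqxx inE negbK.
Qed.

Lemma add_top_inj : injective add_top.
Proof.
move=> g1 g2 /ffunP g12; apply/ffunP => u; apply: val_inj.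
by rewrite /= -!add_top_out g12.
Qed.

Hypotheses (Oop : qopen O) (O1 : cl (restr O) = 1%N).

(** The largest label on [O] breaks no order relation because [O] is an upper
    set, and the points that share it are equivalent because [O] is a single
    class. *)
Lemma add_top_labelings g :
  (add_top g \in labelings P n.+1) = (g \in labelings (restr (~: O)) n).
Proof.
have /qopenP Oup := Oop; have /eqP/cl_eq1P[_ Osim] := O1.
apply/labelingsP/labelingsP => -[gle gsim].
  split=> x y; first by rewrite -!add_top_out; apply: gle.
  by rewrite -val_eqE /= -!add_top_out; apply: gsim.
have splitO x : (x \in O) + {u : restr (~: O) | x = val u}.
  have [xO|xO] := boolP (x \in O); first by left.
  by right; rewrite -in_setC in xO; exists (Sub x xO).
have top x : x \in O -> add_top g x = ord_max.
  by move=> xO; apply/eqP; rewrite add_top_max.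
split=> x y.
  have [/top-> _|[v ->]] := splitO y; first by rewrite -ltnS.
  have [xO /(Oup _ _ xO)|[u ->]] := splitO x; last first.
    by rewrite !add_top_out; apply: gle.
  by have := valP v; rewrite inE => /negPf->.
have [xO|[u ->]] := splitO x; have [yO|[v ->]] := splitO y.
- by rewrite !top // eqxx; apply/esym/(Osim (Sub x xO) (Sub y yO)).
- have vO : val v \in O = false by have := valP v; rewrite inE => /negPf.
  rewrite (top x xO) eq_sym add_top_max vO; apply/esym/negP => /andP[xv _].
  by rewrite (Oup _ _ xO xv) in vO.
- have uO : val u \in O = false by have := valP u; rewrite inE => /negPf.
  rewrite (top y yO) add_top_max uO; apply/esym/negP => /andP[_ yu].
  by rewrite (Oup _ _ yO yu) in uO.
by rewrite -val_eqE /= !add_top_out; apply: gsim.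
Qed.

Lemma card_labelings_top :
  #|[set f in labelings P n.+1 | [set x | f x == ord_max] == O]| =
  #|labelings (restr (~: O)) n|.
Proof.
rewrite -(card_imset _ add_top_inj); apply: eq_card => f.
rewrite inE; apply/andP/imsetP => [[fP /eqP fO]|[g gP ->]]; last first.
  rewrite add_top_labelings; split=> //.
  by apply/eqP/setP => x; rewrite inE add_top_max.
have fmax x : (f x == ord_max) = (x \in O) by rewrite -fO inE.
have f_lt (u : restr (~: O)) : (f (val u) < n)%N.
  have := valP u; rewrite inE -fmax -val_eqE /= => fu.
  by rewrite ltn_neqAle fu -ltnS ltn_ord.
have fE : f = add_top [ffun u => Ordinal (f_lt u)].
  apply/ffunP => x; have [xO|xO] := boolP (x \in O).
    transitivity (@ord_max n); first by apply/eqP; rewrite fmax.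
    by apply/esym/eqP; rewrite add_top_max.
  rewrite -in_setC in xO; apply: val_inj.
  have := add_top_out [ffun u => Ordinal (f_lt u)] (Sub x xO).
  by rewrite ffunE /= => ->.
by exists [ffun u => Ordinal (f_lt u)]; rewrite // -add_top_labelings -fE.
Qed.

End Extension.

(** That [O] is not empty is where [cl P = n.+1] matters: a labeling with as many
    classes as labels is onto. *)
Lemma top_block_open (P : qposet) (n : nat) (f : {ffun P -> 'I_n.+1})
    (O := [set x | f x == ord_max]) :
  cl P = n.+1 -> f \in labelings P n.+1 ->
  qopen O && (cl (restr O) == 1%N).
Proof.
move=> clP /labelingsP[fle fsim]; apply/andP; split.
  apply/qopenP => x y; rewrite !inE => /eqP fx /fle; rewrite fx /= => le_n.
  by rewrite -val_eqE /= eqn_leq le_n -ltnS ltn_ord.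
have fT : f @: [set: P] = [set: 'I_n.+1].
  apply/eqP; rewrite eqEcard subsetT cardsT card_ord -(cl_imset fsim) clP.
  exact: leqnn.
have /imsetP[x _ fx] : ord_max \in f @: [set: P] by rewrite fT inE.
apply/cl_eq1P; split.
  by apply/card_gt0P; have xO : x \in O; [rewrite inE -fx | exists (Sub x xO)].
move=> u v; rewrite [qsim _ _ _](_ : _ = qsim P (val u) (val v)) // -fsim.
by have := valP u; have := valP v; rewrite !inE => /eqP-> /eqP->.
Qed.

(** The class [O] with the largest label is open because no class lies above it;
    removing it leaves a heap-ordering of the rest. *)
Lemma heap_num_rec (P : qposet) : (0 < cl P)%N ->
  heap_num P = (\sum_(O : {set P} | qopen O && (cl (restr O) == 1%N))
                  heap_num (restr (~: O)))%N.
Proof.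
case clP: (cl P) => [//|n] _.
rewrite heap_num_labelings clP -sum1_card.
rewrite (partition_big (fun f : {ffun P -> 'I_n.+1} => [set x | f x == ord_max])
  (fun O => qopen O && (cl (restr O) == 1%N))) /=; last first.
  by move=> f; apply: top_block_open.
apply: eq_bigr => O /andP[Oop /eqP O1].
have -> : heap_num (restr (~: O)) = #|labelings (restr (~: O)) n|.
  rewrite heap_num_labelings; congr #|labelings _ _|.
  by have := cl_restrC Oop; rewrite O1 addn1 clP => -[].
rewrite -(card_labelings_top n Oop O1) -sum1_card.
by apply: eq_bigl => f; rewrite [in RHS]inE.
Qed.

Lemma heap_num_cl0 (P : qposet) : cl P = 0%N -> heap_num P = 1%N.
Proof.
move=> clP; rewrite heap_num_labelings clP; move/eqP: clP; rewrite cl_eq0 => P0.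
have P0' (x : P) : False by move: (card0_eq (eqP P0) x); rewrite inE.
apply/eqP/cards1P.
exists [ffun x => match P0' x with end]; apply/setP => f; rewrite in_set1.
have -> : f = [ffun x => match P0' x with end] by apply/ffunP => x; case: (P0' x).
by rewrite eqxx; apply/labelingsP; split=> x; case: (P0' x).
Qed.

(** * Coefficients of the coproduct of polynomials *)

Lemma coef_XaddC_exp (R : comNzRingType) (c : R) n :
  (('X + c%:P) ^+ n.+1)`_n = c *+ n.+1.
Proof.
rewrite exprDn coef_sum (bigD1 (inord 1)) //= inordK // big1 => [|i i1].
  by rewrite subn1 expr1 bin1 addr0 coefMn coefMC coefXn eqxx mul1r.
rewrite coefMn -polyC_exp coefMC coefXn [_ == _]negbTE ?mul0r ?mul0rn //.
apply: contraNneq i1 => ni; apply/eqP/val_inj; rewrite /= inordK //.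
have le_i := ltn_ord i; rewrite ltnS in le_i.
by have := subKn le_i; rewrite -ni subSnn.
Qed.

(** The inner coefficient of index 1 singles out the terms of degree one in
    1 (x) X. *)
Lemma coef_pDelta (K : fieldType) (a : K) n :
  (pDelta (a *: 'X^(n.+1)))`_n`_1 = a *+ n.+1.
Proof.
rewrite /pDelta map_polyZ map_polyXn comp_polyZ comp_Xn_poly coefZ coef_XaddC_exp.
by rewrite coefCM coefMn coefX mulrnAr mulr1.
Qed.

Lemma coef_ptensor (K : fieldType) (p q : {poly K}) i j :
  (ptensor p q)`_i`_j = p`_i * q`_j.
Proof. by rewrite /ptensor coefMC coef_map coefCM. Qed.

(** * Contractions *)

Lemma cl_qquo (P : qposet) (E : eqv P) : compat E -> cl (qquo E) = ecl E.
Proof.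
move=> /andP[_ /forallP simE]; rewrite clE /ecl.
congr #|pred_of_set _|; apply: eq_imset => x; apply/setP => y; rewrite !inE.
by have /forallP/(_ y)/eqP := simE x.
Qed.

Fact eqv_full_subproof (T : finType) : is_equiv [set: T * T].
Proof.
apply/andP; split; first by apply/is_preorderP; split=> [x|y x z _ _]; rewrite inE.
by apply/forallP => x; apply/forallP => y; rewrite !inE.
Qed.
Definition eqv_full (T : finType) : eqv T := Eqv (eqv_full_subproof T).

Lemma eqv_fullE (T : finType) (x y : T) : eqv_full T x y.
Proof. exact: in_setT. Qed.

Lemma qsim_qquo_full (P : qposet) (x y : P) : qsim (qquo (eqv_full P)) x y.
Proof. by apply/andP; split; apply/connect1; rewrite /= eqv_fullE orbT. Qed.

Lemma compat_full (P : qposet) : qconnected P -> compat (eqv_full P).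
Proof.
move=> Pc; apply/andP; split; apply/forallP => x.
  (* The restriction of P to the only class is the whole of P. *)
  rewrite -(qiso_connected (_ : qiso P _)) //; apply/qisoP.
  have inP y : y \in [set y | eqv_full P x y] by rewrite inE eqv_fullE.
  exists (fun y : P => Sub y (inP y) : restr [set y | eqv_full P x y]) => //.
  by exists val => // u; apply: val_inj.
by apply/forallP => y; rewrite qsim_qquo_full eqv_fullE.
Qed.

(** * Values of the homogeneous morphism *)

Section Phi0.
Variables (K : fieldType) (phi0 : {lrmorphism Hqp K -> {poly K}}).
Hypotheses (phi0_hopf : hopf_morphism phi0) (phi0_homogeneous : homogeneous phi0)
  (phi0_indisc : forall n : nat, (0 < n)%N -> phi0 (cls K (indisc n)) = 'X).

(** The coefficient in the only degree that homogeneity allows, as [phi0_cls]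
    shows. *)
Definition coefcl (P : qposet) : K := (phi0 (cls K P))`_(cl P).

Lemma phi0_cls (P : qposet) : phi0 (cls K P) = coefcl P *: 'X^(cl P).
Proof.
have [c|a phi0P] := phi0_homogeneous (n := cl P) (x := cls K P).
  by rewrite msuppU1 => /fset1P->; apply/cl_iso/irepr_isocl.
by rewrite /coefcl phi0P coefZ coefXn eqxx mulr1.
Qed.

Lemma phi0_cl1 (P : qposet) : cl P = 1%N -> phi0 (cls K P) = 'X.
Proof. by move=> /isocl_cl1[n n0]; rewrite /cls => ->; apply: phi0_indisc. Qed.

Lemma coef1_phi0 (P : qposet) : (phi0 (cls K P))`_1 = (cl P == 1%N)%:R.
Proof.
have [/phi0_cl1->|clP] := eqVneq (cl P) 1%N; first by rewrite coefX.
by rewrite phi0_cls coefZ coefXn eq_sym (negPf clP) mulr0.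
Qed.

Lemma tensor_map_Delta (P : qposet) :
  tensor_map phi0 phi0 (Delta (cls K P)) = \sum_(O : {set P} | qopen O)
    ptensor (phi0 (cls K (restr (~: O)))) (phi0 (cls K (restr O))).
Proof.
rewrite DeltaE /tensor_map raddf_sum; apply: eq_bigr => O _.
rewrite -[LHS]/(mmap _ _ _) mmapU.
by rewrite -[X in X * _]/(1%:P%:P) !polyC1 mul1r.
Qed.

(** Comparison of the coefficients of X^(n-1) (x) X in the two expressions of
    the coproduct of phi0 P, with n = cl P. *)
Lemma coefcl_rec (P : qposet) : (0 < cl P)%N ->
  coefcl P *+ cl P = \sum_(O : {set P} | qopen O && (cl (restr O) == 1%N))
    coefcl (restr (~: O)).
Proof.
case clP: (cl P) => [//|n] _.
have := congr1 (fun p : {poly {poly K}} => p`_n`_1) (phi0_hopf.1 (cls K P)).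
rewrite phi0_cls clP coef_pDelta tensor_map_Delta => ->.
rewrite !coef_sum big_mkcondr; apply: eq_bigr => O Oop.
rewrite coef_ptensor [X in _ * X]coef1_phi0; case: eqP => O1; last by rewrite mulr0.
rewrite mulr1 /coefcl; congr (_)`__.
by have := cl_restrC Oop; rewrite O1 addn1 clP => -[].
Qed.

(** Both sides satisfy the same recursion once the factor [cl P] is divided out,
    which characteristic zero allows. *)
Lemma phi0_heap (charK0 : [pchar K] =i pred0) (P : qposet) :
  phi0 (cls K P) = ((heap_num P)%:R / ((cl P)`!)%:R) *: 'X^(cl P).
Proof.
have nz n : (0 < n)%N -> n%:R != 0 :> K.
  by move/pcharf0P: charK0 => -> ; rewrite lt0n.
rewrite phi0_cls; congr (_ *: _).
have [n] := ubnP (cl P); elim: n => // n IHn in P *; rewrite ltnS => le_n.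
have [cl0|cl0] := posnP (cl P).
  rewrite heap_num_cl0 // cl0 divr1 /coefcl cl0.
  move/eqP: cl0; rewrite cl_eq0 -isocl_eq1 => /eqP P1.
  by rewrite /cls P1 rmorph1 coef1.
apply: (mulIf (nz _ cl0)); rewrite mulr_natr coefcl_rec //.
have fE : (cl P)`! = (cl P * (cl P).-1`!)%N by rewrite -{1}(prednK cl0) factS prednK.
rewrite fE natrM invfM -mulrA mulrAC mulVf ?nz // mul1r.
rewrite heap_num_rec // natr_sum mulr_suml.
apply: eq_bigr => O /andP[Oop /eqP O1].
have clO : cl P = (cl (restr (~: O))).+1 by rewrite (cl_restrC Oop) O1 addn1.
by rewrite IHn; [rewrite clO | rewrite -clO].
Qed.

(** * Action of a character on the homogeneous morphism *)

Section Act.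
Variables (alpha : {lrmorphism Hqp K -> K | *%R}).

Lemma act_cls (P : qposet) : act phi0 alpha (cls K P) =
  \sum_(E : eqv P | compat E) alpha (cls K (qsub E)) *: phi0 (cls K (qquo E)).
Proof.
by rewrite /act deltaE raddf_sum; apply: eq_bigr => E _; rewrite /= lextU.
Qed.

Lemma act_heap (charK0 : [pchar K] =i pred0) (P : qposet) :
  act phi0 alpha (cls K P) = \sum_(E : eqv P | compat E)
    ((heap_num (qquo E))%:R / ((ecl E)`!)%:R * alpha (cls K (qsub E)))
      *: 'X^(ecl E).
Proof.
rewrite act_cls; apply: eq_bigr => E cE.
by rewrite phi0_heap // cl_qquo // scalerA mulrC.
Qed.

(** The term of [E] has degree [ecl E], so only equivalences with one class
    reach the coefficient of X. *)
Lemma coef1_act (P : qposet) : (0 < #|P|)%N -> qconnected P ->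
  alpha (cls K P) = (act phi0 alpha (cls K P))^`().[0].
Proof.
move=> P0 Pc; rewrite horner_coef0 coef_deriv mulr1n act_cls coef_sum.
rewrite (bigD1 (eqv_full P)) ?compat_full //= big1 => [|E /andP[cE nE]].
  rewrite addr0 coefZ coef1_phi0 [cl _ == _](_ : _ = true).
    rewrite mulr1 /cls; congr (alpha << _ >>); apply/eqP; rewrite isocl_eq.
    apply/qisoP; exists (id : P -> qsub (eqv_full P)); first by exists id.
    by move=> x y; rewrite /qle /= /qsub_le eqv_fullE andbT.
  by apply/cl_eq1P; split=> // x y; apply: qsim_qquo_full.
rewrite coefZ coef1_phi0; case: cl_eq1P => [[_ simE]|]; last by rewrite mulr0.
case/negP: nE; apply/eqP/val_inj/setP => -[x y]; rewrite inE.
move/andP: cE => [_ /forallP/(_ x)/forallP/(_ y)/eqP E_xy].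
by rewrite -[LHS]/(E x y) -E_xy simE.
Qed.

End Act.
End Phi0.

Theorem theorem35 (K : fieldType) (charK0 : [pchar K] =i pred0)
  (ehr ehr_str : {linear Hqp K -> {poly K}})
  (ehrE : forall (P : qposet) (k : nat), (0 < k)%N ->
     (ehr (cls K P)).[k%:R] = (lin_num P k)%:R)
  (ehr_strE : forall (P : qposet) (k : nat), (0 < k)%N ->
     (ehr_str (cls K P)).[k%:R] = (strict_lin_num P k)%:R)
  (phi0 : {lrmorphism Hqp K -> {poly K}})
  (phi0_hopf : hopf_morphism phi0)
  (phi0_homogeneous : homogeneous phi0)
  (phi0_indisc : forall n : nat, (0 < n)%N -> phi0 (cls K (indisc n)) = 'X)
  (alpha alpha_str : {lrmorphism Hqp K -> K | *%R})
  (alphaE : forall x, ehr x = act phi0 alpha x)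
  (alpha_strE : forall x, ehr_str x = act phi0 alpha_str x) :
  (forall P : qposet, (0 < #|P|)%N -> qconnected P ->
     alpha (cls K P) = (ehr (cls K P))^`().[0]
     /\ alpha_str (cls K P) = (ehr_str (cls K P))^`().[0])
  /\
  (forall P : qposet,
     ehr (cls K P) =
       \sum_(E : eqv P | compat E)
          ((heap_num (qquo E))%:R / ((ecl E)`!)%:R * alpha (cls K (qsub E)))
            *: 'X^(ecl E)
     /\
     ehr_str (cls K P) =
       \sum_(E : eqv P | compat E)
          ((heap_num (qquo E))%:R / ((ecl E)`!)%:R * alpha_str (cls K (qsub E)))
            *: 'X^(ecl E)).
Proof.
split=> P *; rewrite alphaE alpha_strE.
  by split; apply: coef1_act.
by split; apply: act_heap.
Qed.
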